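(* There exist an even lattice polytope $Q\subset\mathbb{R}^n$ (for some $n$), a lattice point $y\in\operatorname{int}(Q)$ with $y\in Q^*$, and a polynomial $f\in P_Q^y\setminus\Sigma_Q^y$.
   Context: A lattice polytope is even if all its vertices lie in $(2\mathbb{N})^n$, where $\mathbb{N}=\{0,1,2,\dots\}$. Let $\operatorname{vert}(Q)$ be the vertex set of $Q$. $AP_Q^y$ is the set of real polynomials of the form $\sum_{\alpha\in\operatorname{vert}(Q)}b_\alpha\mathbf{x}^\alpha+c\,\mathbf{x}^y$ supported on the vertices of $Q$ and the interior lattice point $y$. $P_Q^y$ is the set of polynomials in $AP_Q^y$ that are nonnegative on $\mathbb{R}^n$, and $\Sigma_Q^y$ is the set of polynomials in $AP_Q^y$ that are sums of squares of real polynomials. For $L\subseteq Q\cap\mathbb{Z}^n$ put $\overline{A}(L)=\{\tfrac12(s+t)\in\mathbb{Z}^n: s\ne t,\ s,t\in L\cap(2\mathbb{Z})^n\}$. $L$ is called mediated (with respect to $\operatorname{vert}(Q)$) if $\operatorname{vert}(Q)\subseteq L\subseteq\overline{A}(L)\cup\operatorname{vert}(Q)$. $Q^*$ denotes the (unique) maximal mediated set, which contains every mediated set. *)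

(* Defs.v *)
From HB Require Import structures.
From mathcomp Require Import all_boot all_order all_algebra.
(* mpoly has to be imported before MathComp-Analysis: in the opposite order
   their notations clash. *)
From mathcomp Require Import mpoly.
From mathcomp Require Import all_classical reals topology normedtype.

Set Implicit Arguments.
Unset Strict Implicit.
Unset Printing Implicit Defensive.

Import Order.TTheory GRing.Theory Num.Theory.

Local Open Scope classical_set_scope.
Local Open Scope ring_scope.

Definition lattice (R : realType) (n : nat) : set 'rV[R]_n :=
  [set v | forall i, v 0 i \is a Num.int].

Definition even_lattice (R : realType) (n : nat) : set 'rV[R]_n :=
  [set v | forall i, exists z : int, v 0 i = 2 * z%:~R].

Definition even_nat_vectors (R : realType) (n : nat) : set 'rV[R]_n :=
  [set v | forall i, exists k : nat, v 0 i = 2 * k%:R].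

Definition conv_hull (R : realType) (n m : nat) (p : 'I_m -> 'rV[R]_n) :
    set 'rV[R]_n :=
  [set x | exists l : 'I_m -> R,
     [/\ forall j, 0 <= l j, \sum_j l j = 1 & x = \sum_j l j *: p j]].

(* The vertices are the zero-dimensional faces: [v] is the only maximiser over
   [Q] of some linear functional [x |-> \sum_i c_i x_i]. *)
Definition vert (R : realType) (n : nat) (Q : set 'rV[R]_n) : set 'rV[R]_n :=
  [set v | Q v /\ exists c : 'rV[R]_n, forall x, Q x -> x <> v ->
     \sum_i c 0 i * x 0 i < \sum_i c 0 i * v 0 i].

Definition polytope (R : realType) (n : nat) (Q : set 'rV[R]_n) : Prop :=
  exists (m : nat) (p : 'I_m -> 'rV[R]_n), Q = conv_hull p.

Lemma vert_conv_hull (R : realType) (n m : nat) (p : 'I_m -> 'rV[R]_n) :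
  vert (conv_hull p) `<=` range p.
Proof.
move=> v [[l [l0 l1 vE]] [c cmax]]; apply: contrapT => vp.
pose dot (x : 'rV[R]_n) := \sum_i c 0 i * x 0 i.
have pQ j : conv_hull p (p j).
  exists (fun k => (k == j)%:R); split=> [k||]; first exact: ler0n.
    by rewrite (bigD1 j) //= eqxx big1 ?addr0 // => k /negPf ->.
  by rewrite (bigD1 j) //= eqxx scale1r big1 ?addr0 // => k /negPf ->; rewrite scale0r.
have lt_p j : dot (p j) < dot v.
  by apply: cmax => // pj; apply: vp; exists j.
have dotE : dot v = \sum_j l j * dot (p j).
  transitivity (\sum_i \sum_j l j * (c 0 i * p j 0 i)).
    apply: eq_bigr => i _; rewrite vE summxE mulr_sumr.
    by apply: eq_bigr => j _; rewrite mxE mulrCA.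
  by rewrite exchange_big; apply: eq_bigr => j _; rewrite mulr_sumr.
have : \sum_j l j * (dot v - dot (p j)) = 0.
  under eq_bigr => j _ do rewrite mulrBr.
  by rewrite sumrB -mulr_suml l1 mul1r -dotE subrr.
move/eqP; rewrite psumr_eq0 => [/allP lz|j _]; last first.
  by rewrite mulr_ge0 // subr_ge0 ltW.
have : \sum_j l j = 0.
  apply: big1 => j _; have := lz j (mem_index_enum j).
  by rewrite mulf_eq0 subr_eq0 (gt_eqF (lt_p j)) orbF => /eqP.
by rewrite l1 => /eqP; rewrite oner_eq0.
Qed.

Lemma finite_vert (R : realType) (n : nat) (Q : set 'rV[R]_n) :
  polytope Q -> finite_set (vert Q).
Proof.
move=> [m [p ->]]; apply: (sub_finite_set (@vert_conv_hull _ _ _ p)).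
exact: finite_image.
Qed.

Definition lattice_polytope (R : realType) (n : nat) (Q : set 'rV[R]_n) : Prop :=
  polytope Q /\ vert Q `<=` @lattice R n.

Definition even_lattice_polytope (R : realType) (n : nat) (Q : set 'rV[R]_n) :
    Prop :=
  lattice_polytope Q /\ vert Q `<=` @even_nat_vectors R n.

Definition midpoints (R : realType) (n : nat) (L : set 'rV[R]_n) :
    set 'rV[R]_n :=
  [set x | @lattice R n x /\ exists s t : 'rV[R]_n,
     [/\ s <> t, (L `&` @even_lattice R n) s, (L `&` @even_lattice R n) t &
         x = 2^-1 *: (s + t)]].

Definition mediated (R : realType) (n : nat) (Q L : set 'rV[R]_n) : Prop :=
  [/\ L `<=` Q `&` @lattice R n, vert Q `<=` L &
      L `<=` midpoints L `|` vert Q].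

(* The maximal mediated set Q^* is the union of all mediated sets; that it is
   itself mediated is [max_mediated_mediated]. *)
Definition max_mediated (R : realType) (n : nat) (Q : set 'rV[R]_n) :
    set 'rV[R]_n :=
  [set x | exists2 L, mediated Q L & L x].

Lemma mediated_sub_max (R : realType) (n : nat) (Q L : set 'rV[R]_n) :
  mediated Q L -> L `<=` max_mediated Q.
Proof. by move=> QL x Lx; exists L. Qed.

Lemma max_mediated_mediated (R : realType) (n : nat) (Q : set 'rV[R]_n) :
  lattice_polytope Q -> mediated Q (max_mediated Q).
Proof.
move=> [_ Qlat].
have Vmed : mediated Q (vert Q).
  split=> [x Vx||x Vx]; [split; last exact: Qlat | by [] | by right].
  by case: Vx.
split.
- by move=> x [L [LQ _ _] Lx]; exact: LQ.
- by move=> x Vx; exists (vert Q).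
- move=> x [L QL Lx]; have [_ _ /(_ _ Lx) [|Vx]] := QL; last by right.
  move=> [xlat [s [t [st [Ls es] [Lt et] xE]]]]; left; split=> //.
  by exists s, t; split=> //; split=> //; exists L.
Qed.

Definition mnm_point (R : realType) (n : nat) (a : 'X_{1..n}) : 'rV[R]_n :=
  \row_i (a i)%:R.

Lemma mnm_point_inj (R : realType) (n : nat) : injective (@mnm_point R n).
Proof.
move=> a b ab; apply/mnmP => i; apply/eqP; rewrite -(eqr_nat R).
by have /rowP/(_ i) := ab; rewrite !mxE => ->.
Qed.

Lemma finite_vert_mnm (R : realType) (n : nat) (Q : set 'rV[R]_n) :
  polytope Q -> finite_set [set a | vert Q (mnm_point R a)].
Proof.
move=> /finite_vert; apply: finite_preimage => a b _ _.
exact: mnm_point_inj.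
Qed.

(* An exponent is a multinomial, i.e. a vector of N^n: this loses no vertex and
   no lattice point of an even lattice polytope, which lies in the nonnegative
   orthant.  The coefficients [b] and [c] are arbitrary reals, possibly 0.
   The sum is a finite one by [finite_vert_mnm]. *)
Definition AP (R : realType) (n : nat) (Q : set 'rV[R]_n) (y : 'X_{1..n}) :
    set {mpoly R[n]} :=
  [set f | exists (b : 'X_{1..n} -> R) (c : R),
     f = \sum_(a \in [set a | vert Q (mnm_point R a)]) b a *: 'X_[a]
         + c *: 'X_[y]].

Definition P (R : realType) (n : nat) (Q : set 'rV[R]_n) (y : 'X_{1..n}) :
    set {mpoly R[n]} :=
  [set f | AP Q y f /\ forall x : 'I_n -> R, 0 <= f.@[x]].

Definition Sigma (R : realType) (n : nat) (Q : set 'rV[R]_n) (y : 'X_{1..n}) :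
    set {mpoly R[n]} :=
  [set f | AP Q y f /\ exists s : seq {mpoly R[n]}, f = \sum_(g <- s) g ^+ 2].

(* Main.v *)
Require Import Defs.
From HB Require Import structures.
From mathcomp Require Import all_boot all_order all_algebra.
From mathcomp Require Import mpoly.
From mathcomp Require Import all_classical reals topology normedtype.
From mathcomp Require Import zify ring lra.
Import Order.TTheory GRing.Theory Num.Theory.
Import numFieldNormedType.Exports.

Set Implicit Arguments.
Unset Strict Implicit.
Unset Printing Implicit Defensive.

Local Open Scope classical_set_scope.
Local Open Scope ring_scope.

(** A polynomial in [AP Q y] may have zero coefficients at some vertices of Q, so
enlarging Q can enlarge its maximal mediated set while the polynomial stays fixed.
Start from the Motzkin polynomial x^4 y^2 + x^2 y^4 + 1 - 3 x^2 y^2: it is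
nonnegative but not a sum of squares, and it is supported on the vertices of the
triangle with vertices (0,0), (4,2), (2,4) and on the centroid (2,2) of that
triangle.  The triangle itself would not do, since (2,2) is not in its maximal
mediated set.  Adding the even points (4,0) and (0,4) gives a convex pentagon
that keeps the three old points as vertices, keeps (2,2) in the interior, and has
(2,2) as the midpoint of two even vertices; so (2,2) lies in the maximal mediated
set of the pentagon.

Nonnegativity is the arithmetic-geometric mean inequality, made explicit in
[motzkin_ge0].  That the polynomial is no sum of squares rests on two facts
about an arbitrary sum of squares of real polynomials.  By [mcoeff_sos], no
cancellation occurs at twice an exponent a which is not the midpoint of two
other exponents in the supports of the squared polynomials: the coefficient
there is the sum of the squares of the coefficients at a.  By [half_weight],
these supports lie in half the Newton polytope of the sum.  For the Motzkin
polynomial, the half polytope only contains the lattice points (0,0), (1,1),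
(2,1), (1,2), among which (1,1) is a midpoint only of itself; hence the
coefficient of x^2 y^2 would be nonnegative, whereas it is -3. *)

(** * Supports of the terms of a sum of squares *)

Section SumsOfSquares.
Variables (R : realFieldType) (n : nat).
Implicit Types (s : seq {mpoly R[n]}) (a b c : 'X_{1..n}).

Definition supports s : seq 'X_{1..n} := flatten [seq msupp g | g <- s].

Lemma mem_supports s g b : g \in s -> g@_b != 0 -> b \in supports s.
Proof.
by move=> gs gb; apply/flatten_mapP; exists g; rewrite ?mcoeff_msupp.
Qed.

(** A product of two monomials of some g that contributes to the coefficient at
2a comes from two exponents with midpoint a; by hypothesis only the square of the
monomial of exponent a is left. *)
Lemma mcoeff_sos s a :
    {in supports s &, forall b c, (b + c = a + a)%MM -> b = a} ->
  (\sum_(g <- s) g ^+ 2)@_(a + a) = \sum_(g <- s) g@_a ^+ 2.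
Proof.
move=> extr; rewrite linear_sum /= !big_seq; apply: eq_bigr => g gs.
have la : (mdeg a < (mdeg (a + a)%MM).+1)%N by rewrite mdegD ltnS leq_addr.
rewrite !expr2 mcoeffM (bigD1 (BMultinom la, BMultinom la)) //=.
rewrite big1 ?addr0 // => -[b c] /= /andP[/eqP bcE bca].
have [->|gb] := eqVneq (g@_b) 0; first exact: mul0r.
have [->|gc] := eqVneq (g@_c) 0; first exact: mulr0.
have Eb : b = a :> 'X_{1..n}.
  by apply: (extr b c); rewrite ?(mem_supports gs).
have Ec : c = a :> 'X_{1..n}.
  by apply: (extr c b); rewrite ?(mem_supports gs) // addmC.
by case/eqP: bca; congr pair; apply: val_inj.
Qed.

Lemma seq_argmax (T : eqType) (d : Order.disp_t) (K : orderType d)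
    (key : T -> K) (r : seq T) (x : T) :
  x \in r -> exists2 y, y \in r & {in r, forall z, (key z <= key y)%O}.
Proof.
elim: r x => // x0 r IH x _; case: r IH => [|x1 r] IH.
  by exists x0 => [|z]; rewrite ?mem_head // inE => /eqP ->.
have [y yr ymax] := IH x1 (mem_head _ _).
have [le|/ltW le] := leP (key x0) (key y).
  by exists y; [rewrite inE yr orbT | move=> z /predU1P[->|/ymax]].
exists x0; rewrite ?mem_head // => z /predU1P[->//|/ymax zy].
exact: le_trans zy le.
Qed.

Definition weight (w : 'I_n -> int) a : int := \sum_i w i * (a i)%:Z.

Lemma weightD w a b : weight w (a + b)%MM = weight w a + weight w b.
Proof.
by rewrite -big_split; apply: eq_bigr => i _; rewrite mnmDE PoszD mulrDr.
Qed.

(** If the largest weight is attained at a single exponent of the supports, the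
double of this exponent occurs in the sum by [mcoeff_sos], which bounds the
weight.  Otherwise the monomial order breaks the tie: since it is compatible with
addition, its maximum is not a midpoint of other exponents of the same weight. *)
Lemma half_weight s (w : 'I_n -> int) (d : int) :
    {in msupp (\sum_(g <- s) g ^+ 2), forall a, weight w a <= d *+ 2} ->
  {in supports s, forall a, weight w a <= d}.
Proof.
move=> le_d a0 a0s.
have [a1 a1s a1max] := seq_argmax (weight w) a0s.
apply: (le_trans (a1max _ a0s)).
pose top := [seq b <- supports s | weight w b == weight w a1].
have a1top : a1 \in top by rewrite mem_filter eqxx.
have [a atop amax] := seq_argmax id a1top.
move: (atop); rewrite mem_filter => /andP[/eqP wa as_].
(* If b + c = 2a then b and c also have the largest weight, so both are below a
   in the monomial order. *)
have extr : {in supports s &, forall b c, (b + c = a + a)%MM -> b = a}.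
  move=> b c bs cs bcE.
  have : weight w b + weight w c = weight w a + weight w a.
    by rewrite -!weightD bcE.
  have := a1max _ bs; have := a1max _ cs; rewrite wa => wc wb wbc.
  have btop : b \in top by rewrite mem_filter bs andbT; apply/eqP; lia.
  have ctop : c \in top by rewrite mem_filter cs andbT; apply/eqP; lia.
  have /= := amax _ btop; rewrite le_eqVlt => /predU1P[//|ba].
  by have := ltmc_le_add ba (amax _ ctop); rewrite bcE ltxx.
have /le_d : (a + a)%MM \in msupp (\sum_(g <- s) g ^+ 2).
  rewrite mcoeff_msupp mcoeff_sos // psumr_eq0 => [|g _]; last exact: sqr_ge0.
  have /flatten_mapP[g gs ga] := as_.
  apply/allPn; exists g => //=; rewrite expf_eq0 /=.
  by rewrite -mcoeff_msupp.
rewrite weightD -wa; lia.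
Qed.
End SumsOfSquares.

(** * Vertices of a convex hull *)

(** The gap between the value of the functional at the generator j and at a
convex combination is the convex combination of the gaps at the generators, all
positive but the j-th; it vanishes only if all the mass is on j. *)
Lemma vert_generator (R : realType) (n m : nat) (p : 'I_m -> 'rV[R]_n)
    (c : 'rV[R]_n) (j : 'I_m) :
    (forall k, k != j -> \sum_i c 0 i * p k 0 i < \sum_i c 0 i * p j 0 i) ->
  vert (conv_hull p) (p j).
Proof.
move=> jmax; split.
  exists (fun k => (k == j)%:R); split=> [k||]; first exact: ler0n.
    by rewrite (bigD1 j) //= eqxx big1 ?addr0 // => k /negPf ->.
  rewrite (bigD1 j) //= eqxx scale1r big1 ?addr0 // => k /negPf ->.
  by rewrite scale0r.
exists c => x [l [l0 l1 xE]] xpj.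
pose dot (v : 'rV[R]_n) := \sum_i c 0 i * v 0 i.
have dotE : dot x = \sum_k l k * dot (p k).
  transitivity (\sum_i \sum_k l k * (c 0 i * p k 0 i)).
    apply: eq_bigr => i _; rewrite xE summxE mulr_sumr.
    by apply: eq_bigr => k _; rewrite mxE mulrCA.
  by rewrite exchange_big; apply: eq_bigr => k _; rewrite mulr_sumr.
have le_j k : dot (p k) <= dot (p j).
  by have [->|/jmax/ltW] := eqVneq k j.
have gap_ge0 k : true -> 0 <= l k * (dot (p j) - dot (p k)).
  by rewrite mulr_ge0 // subr_ge0.
have gapE : dot (p j) - dot x = \sum_k l k * (dot (p j) - dot (p k)).
  under eq_bigr => k _ do rewrite mulrBr.
  by rewrite sumrB -mulr_suml l1 mul1r dotE.
rewrite -subr_gt0 [ltRHS]gapE lt0r sumr_ge0 // andbT.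
apply: contra_notN xpj; rewrite psumr_eq0 // => /allP gap0.
have l_0 k : k != j -> l k = 0.
  move=> kj; have := gap0 k (mem_index_enum k).
  rewrite mulf_eq0 subr_eq0 => /orP[/eqP//|/eqP E].
  by have := jmax k kj; rewrite -/(dot _) -/(dot (p j)) E ltxx.
have lj : l j = 1.
  by rewrite -l1 (bigD1 j) //= big1 ?addr0.
rewrite xE (bigD1 j) //= lj scale1r big1 ?addr0 // => k kj.
by rewrite l_0 // scale0r.
Qed.

(** * Exponents in two variables *)

Lemma sum2E (V : nmodType) (F : 'I_2 -> V) :
  \sum_i F i = F ord0 + F (lift ord0 ord0).
Proof. by rewrite !big_ord_recl big_ord0 addr0. Qed.

Definition mon2 (i j : nat) : 'X_{1..2} := [multinom [tuple i; j]].

Lemma mon2_0 i j : mon2 i j ord0 = i.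
Proof. by rewrite (mnm_nth 0%N). Qed.

Lemma mon2_1 i j : mon2 i j (lift ord0 ord0) = j.
Proof. by rewrite (mnm_nth 0%N). Qed.

Lemma mon2E i j (k : 'I_2) : mon2 i j k = if k == ord0 then i else j.
Proof. by case: k => -[|[|//]] lt; rewrite (mnm_nth 0%N). Qed.

Lemma mon2_eta (a : 'X_{1..2}) : mon2 (a ord0) (a (lift ord0 ord0)) = a.
Proof.
by apply/mnmP => -[[|[|//]] lt]; rewrite mon2E;
  congr (fun_of_multinom _ _); apply: val_inj.
Qed.

Lemma mon2D i j k l : (mon2 i j + mon2 k l)%MM = mon2 (i + k) (j + l).
Proof. by apply/mnmP => e; rewrite mnmDE !mon2E; case: ifP. Qed.

Lemma mon2_eq i j k l : (mon2 i j == mon2 k l) = (i == k) && (j == l).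
Proof.
apply/eqP/andP => [E|[/eqP-> /eqP->]//].
by rewrite -(mon2_0 i j) -{2}(mon2_1 i j) E mon2_0 mon2_1.
Qed.

(** * The pentagon *)

Definition pentagon_exps : 5.-tuple 'X_{1..2} :=
  [tuple mon2 0 0; mon2 4 0; mon2 4 2; mon2 2 4; mon2 0 4].

(** The j-th entry is a linear functional whose maximum on [pentagon_exps] is
attained at the j-th exponent only. *)
Definition pentagon_normals : seq (int * int) :=
  [:: (-1, -1); (2, -1); (2, 1); (1, 2); (-1, 2)].

Section Pentagon.
Variable R : realType.

Definition pentagon_pt (j : 'I_5) : 'rV[R]_2 :=
  mnm_point R (tnth pentagon_exps j).

Definition pentagon : set 'rV[R]_2 := conv_hull pentagon_pt.

Lemma vert_pentagon_pt j : vert pentagon (pentagon_pt j).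
Proof.
pose c := nth (0, 0) pentagon_normals j.
apply: (@vert_generator _ _ _ _
  (\row_i (if i == ord0 then c.1 else c.2)%:~R)) => k.
rewrite !sum2E !mxE !(tnth_nth 0%MM) {}/c.
case: j k => -[|[|[|[|[|//]]]]] ? [[|[|[|[|[|//]]]]] ?] //= _;
  rewrite ?(mon2_0, mon2_1) /=; lra.
Qed.

Lemma vert_pentagonE (a : 'X_{1..2}) :
  vert pentagon (mnm_point R a) <-> a \in pentagon_exps.
Proof.
split=> [/vert_conv_hull[j _ /mnm_point_inj <-]|/tnthP[j ->]].
  exact: mem_tnth.
exact: vert_pentagon_pt.
Qed.

Lemma vert_pentagonP v :
  vert pentagon v -> exists2 a, a \in pentagon_exps & v = mnm_point R a.
Proof.
move=> /vert_conv_hull[j _ <-]; exists (tnth pentagon_exps j) => //.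
exact: mem_tnth.
Qed.

Lemma pentagon_exps_even a i :
  a \in pentagon_exps -> exists k : nat, a i = (2 * k)%N.
Proof.
rewrite !inE => ha; exists (a i)./2; rewrite mul2n even_halfK //.
by case/or4P: ha => [|||/orP[]] /eqP->; rewrite mon2E; case: ifP.
Qed.

Lemma lattice_mnm_point (n : nat) (a : 'X_{1..n}) : lattice (mnm_point R a).
Proof. by move=> i; rewrite mxE rpred_nat. Qed.

Lemma even_pentagon : even_lattice_polytope pentagon.
Proof.
split; first split; first by exists 5%N, pentagon_pt.
  by move=> v /vert_pentagonP[a _ ->]; exact: lattice_mnm_point.
move=> v /vert_pentagonP[a aP ->] i.
by have [k ak] := pentagon_exps_even i aP; exists k; rewrite mxE ak natrM.
Qed.

(** The triangle is the Newton polytope of the Motzkin polynomial, and the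
coefficients are its barycentric coordinates.  At (2,2) they are all 1/3, which
makes this point interior to the pentagon. *)
Lemma triangle_sub_pentagon (x : 'rV[R]_2) :
    0 <= 2 * x 0 ord0 - x 0 (lift ord0 ord0) ->
    0 <= 2 * x 0 (lift ord0 ord0) - x 0 ord0 ->
    x 0 ord0 + x 0 (lift ord0 ord0) <= 6 ->
  pentagon x.
Proof.
set u := x 0 ord0; set v := x 0 (lift ord0 ord0) => u0 v0 uv.
exists (fun j => [:: 1 - (u + v) / 6; 0; (2 * u - v) / 6; (2 * v - u) / 6; 0]`_j).
split.
- by case=> -[|[|[|[|[|//]]]]] ?; rewrite /=; lra.
- by rewrite !big_ord_recl big_ord0 /=; lra.
apply/rowP => i; rewrite summxE !big_ord_recl big_ord0 !mxE !(tnth_nth 0%MM) /=.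
rewrite !mon2E; case: i => -[|[|//]] lt /=.
  by rewrite (_ : Ordinal lt = ord0) -/u; [lra|apply: val_inj].
by rewrite (_ : Ordinal lt = lift ord0 ord0) -/v; [lra|apply: val_inj].
Qed.

Lemma pentagon_interior : pentagon° (mnm_point R (mon2 2 2)).
Proof.
apply/nbhs_ballP; exists (1 / 2) => /=; first lra.
move=> x [_ near_x].
have := near_x 0 ord0; have := near_x 0 (lift ord0 ord0).
rewrite !mxE mon2_0 mon2_1 /ball /= !ltr_norml => /andP[? ?] /andP[? ?].
by apply: triangle_sub_pentagon; lra.
Qed.

(** The point (2,2) is the midpoint of the vertices (4,0) and (0,4), so adding it
to the vertices gives a mediated set. *)
Lemma pentagon_mediated : max_mediated pentagon (mnm_point R (mon2 2 2)).
Proof.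
exists (mnm_point R (mon2 2 2) |` vert pentagon); last by left.
have even_vert v : vert pentagon v -> even_lattice v.
  by move=> /even_pentagon.2 ev i; have [k ->] := ev i; exists k.
split=> [v [->|Vv]|v Vv|v [->|Vv]]; [split|split| | |by right].
- exact: interior_subset pentagon_interior.
- exact: lattice_mnm_point.
- by case: Vv.
- exact: even_pentagon.1.2.
- by right.
left; split; first exact: lattice_mnm_point.
have V40 : vert pentagon (mnm_point R (mon2 4 0)).
  by apply/vert_pentagonE; rewrite !inE eqxx.
have V04 : vert pentagon (mnm_point R (mon2 0 4)).
  by apply/vert_pentagonE; rewrite !inE eqxx.
exists (mnm_point R (mon2 4 0)), (mnm_point R (mon2 0 4)); split.
- by move=> /mnm_point_inj /eqP; rewrite mon2_eq.
- by split; [right|exact: even_vert].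
- by split; [right|exact: even_vert].
by apply/rowP => i; rewrite !mxE !mon2E; case: ifP => _; lra.
Qed.

(** * The Motzkin polynomial *)

Definition motzkin : {mpoly R[2]} :=
  'X_[mon2 4 2] + 'X_[mon2 2 4] + 'X_[mon2 0 0] - 3 *: 'X_[mon2 2 2].

Lemma mcoeff_motzkin a :
  motzkin@_a = (mon2 4 2 == a)%:R + (mon2 2 4 == a)%:R + (mon2 0 0 == a)%:R
               - 3 * (mon2 2 2 == a)%:R.
Proof. by rewrite mcoeffB !mcoeffD mcoeffZ !mcoeffX. Qed.

Lemma motzkin_AP : AP pentagon (mon2 2 2) motzkin.
Proof.
exists (fun a => motzkin@_a), (-3).
have -> : [set a | vert pentagon (mnm_point R a)] = [set` pentagon_exps].
  by apply/seteqP; split=> a /= /vert_pentagonE.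
rewrite -fsbig_seq; last by [].
rewrite /= !big_cons big_nil !mcoeff_motzkin !mon2_eq /=.
rewrite !(mulr0n, mulr1n, mulr0, addr0, add0r, subr0, scale0r, scale1r).
by rewrite scaleNr /motzkin [X in X - _]addrC.
Qed.

(** With t = |uv|, the inequality u^2 + v^2 >= 2t bounds the polynomial below by
2t^3 - 3t^2 + 1 = (t - 1)^2 (2t + 1). *)
Lemma motzkin_ge0 (x : 'I_2 -> R) : 0 <= motzkin.@[x].
Proof.
rewrite mevalB !mevalD mevalZ !mevalX !big_ord_recl !big_ord0 !mon2_0 !mon2_1.
set u := x ord0; set v := x _; set t := `|u * v|.
have t2 : t ^+ 2 = (u * v) ^+ 2 by rewrite real_normK ?num_real.
have uv : (`|u| - `|v|) ^+ 2 = u ^+ 2 + v ^+ 2 - 2 * t.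
  by rewrite sqrrB !real_normK ?num_real // /t normrM; ring.
rewrite (_ : _ - _ = (u * v) ^+ 2 * (`|u| - `|v|) ^+ 2
                     + (t - 1) ^+ 2 * (2 * t + 1)); last first.
  rewrite uv -t2.
  have -> : u ^+ 4 * (v ^+ 2 * 1) + u ^+ 2 * (v ^+ 4 * 1)
          + u ^+ 0 * (v ^+ 0 * 1) - 3 * (u ^+ 2 * (v ^+ 2 * 1))
          = (u * v) ^+ 2 * (u ^+ 2 + v ^+ 2 - 3) + 1 by ring.
  by rewrite -t2; ring.
have t0 : 0 <= t by exact: normr_ge0.
apply: addr_ge0; first by rewrite mulr_ge0 ?sqr_ge0.
by rewrite mulr_ge0 ?sqr_ge0 //; lra.
Qed.

(** The three weights are the facet normals of the Newton triangle, so [le3],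
[le21] and [le12] confine the supports to half of it. *)
Lemma motzkin_not_sos (s : seq {mpoly R[2]}) : motzkin <> \sum_(g <- s) g ^+ 2.
Proof.
move=> sosE.
have half (w0 w1 d : int) :
    {in [:: mon2 4 2; mon2 2 4; mon2 0 0; mon2 2 2], forall a : 'X_{1..2},
      w0 * (a ord0)%:Z + w1 * (a (lift ord0 ord0))%:Z <= d *+ 2} ->
    {in supports s, forall a : 'X_{1..2},
      w0 * (a ord0)%:Z + w1 * (a (lift ord0 ord0))%:Z <= d}.
  move=> le_d a /(@half_weight _ _ s (fun i => if i == ord0 then w0 else w1) d).
  rewrite /weight sum2E /=; apply=> b.
  rewrite -sosE sum2E /= mcoeff_msupp mcoeff_motzkin => b0; apply: le_d.
  apply: contra_neqT b0; rewrite !inE !negb_or !(eq_sym b).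
  move=> /and4P[/negPf-> /negPf-> /negPf-> /negPf->].
  by rewrite mulr0 !addr0 subr0.
have le3 : {in supports s, forall a : 'X_{1..2},
    (a ord0 + a (lift ord0 ord0) <= 3)%N}.
  move=> a /(half 1 1 3) H.
  suff : (1 * (a ord0)%:Z + 1 * (a (lift ord0 ord0))%:Z <= 3) by lia.
  by apply: H => b; rewrite !inE => /or4P[] /eqP->; rewrite mon2_0 mon2_1.
have le21 : {in supports s, forall a : 'X_{1..2},
    (a ord0 <= 2 * a (lift ord0 ord0))%N}.
  move=> a /(half 1 (-2) 0) H.
  suff : (1 * (a ord0)%:Z + (-2) * (a (lift ord0 ord0))%:Z <= 0) by lia.
  by apply: H => b; rewrite !inE => /or4P[] /eqP->; rewrite mon2_0 mon2_1.
have le12 : {in supports s, forall a : 'X_{1..2},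
    (a (lift ord0 ord0) <= 2 * a ord0)%N}.
  move=> a /(half (-2) 1 0) H.
  suff : ((-2) * (a ord0)%:Z + 1 * (a (lift ord0 ord0))%:Z <= 0) by lia.
  by apply: H => b; rewrite !inE => /or4P[] /eqP->; rewrite mon2_0 mon2_1.
have extr : {in supports s &, forall b c,
    (b + c = mon2 1 1 + mon2 1 1)%MM -> b = mon2 1 1}.
  move=> b c bs cs; have := le3 b bs; have := le21 b bs; have := le12 b bs.
  have := le3 c cs; have := le21 c cs; have := le12 c cs.
  rewrite -(mon2_eta b) -(mon2_eta c) !mon2D !(mon2_0, mon2_1).
  move=> h1 h2 h3 h4 h5 h6 /eqP; rewrite mon2_eq => /andP[/eqP e1 /eqP e2].
  by apply/eqP; rewrite mon2_eq; lia.
have := mcoeff_sos extr; rewrite -sosE mon2D mcoeff_motzkin !mon2_eq /=.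
have : 0 <= \sum_(g <- s) g@_(mon2 1 1) ^+ 2.
  by apply: sumr_ge0 => g _; exact: sqr_ge0.
lra.
Qed.
End Pentagon.

Theorem proposition8p1 (R : realType) :
  exists (n : nat) (Q : set 'rV[R]_n) (y : 'X_{1..n}) (f : {mpoly R[n]}),
    [/\ even_lattice_polytope Q,
        Q° (mnm_point R y),
        max_mediated Q (mnm_point R y) &
        (P Q y `\` Sigma Q y) f].
Proof.
exists 2%N, (@pentagon R), (mon2 2 2), (@motzkin R); split.
- exact: even_pentagon.
- exact: pentagon_interior.
- exact: pentagon_mediated.
split; first by split; [exact: motzkin_AP | exact: motzkin_ge0].
by move=> [_ [s]]; exact: motzkin_not_sos.
Qed.
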